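(* Let $\Omega_1,\dots,\Omega_n$ be finite sets, $\Omega=\Omega_1\times\cdots\times\Omega_n$, and let $\mathbf x^1,\dots,\mathbf x^l\in\Omega$ be training data. For fixed $k$ and fixed $\lambda>0$, the minimization of the empirical risk $R_{emp}(P)=-\frac1l\sum_{i=1}^l\ln P(\mathbf x^i)$ over the class $\mathcal H_k^\lambda$ of $k$-factor models is a convex optimization problem, when formulated for $\ln P$ rather than for $P$, as follows. Find a vector $f=\oplus_{\mathbf j}f_{\mathbf j}\in V^k$ with $f_{\mathbf j}\in V_{\mathbf j}$ such that $$\tilde R_{emp}(f):=-\frac1l\sum_{i=1}^l\sum_{\mathbf j}f_{\mathbf j}(\mathbf x^i_{\mathbf j})$$ is minimal subject to the constraints $$Z(f):=\sum_{\mathbf x\in\Omega}\exp\Bigl(\sum_{\mathbf j}f_{\mathbf j}(\mathbf x_{\mathbf j})\Bigr)=1$$ and $$G_{\mathbf x}(f):=\sum_{\mathbf j}f_{\mathbf j}(\mathbf x_{\mathbf j})\ge\ln\lambda\quad\text{for all }\mathbf x\in\Omega .$$ The probability measure $P\in\mathcal H_k^\lambda$ is then given by $\ln P(\mathbf x)=\sum_{\mathbf j}f_{\mathbf j}(\mathbf x_{\mathbf j})$. Here the functions $\tilde R_{emp}$ and $G_{\mathbf x}$ are linear in $f$ and the function $Z$ is convex in $f$; therefore the problem can be solved with standard convex optimization methods.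
   Context: Throughout, $\mathbf j=\{j_1,\dots,j_k\}$ runs over all subsets of $\{1,\dots,n\}$ of size $k$. For each $\mathbf j$, $V_{\mathbf j}$ is the vector space of real-valued functions on $\Omega_{\mathbf j}:=\Omega_{j_1}\times\cdots\times\Omega_{j_k}$, and $V^k:=\oplus_{\mathbf j}V_{\mathbf j}$. For $\mathbf x=(x_1,\dots,x_n)\in\Omega$, $\mathbf x_{\mathbf j}$ is the $k$-tuple given by the restriction of $\mathbf x$ to the variables $x_{j_1},\dots,x_{j_k}$, and $\mathbf x^i_{\mathbf j}$ is the corresponding restriction of the training point $\mathbf x^i$. Model class: $\mathcal H_k^\lambda$ is the set of probability distributions $P$ on $\Omega$ that are bounded below by $\lambda$, i.e. $P(\mathbf x)\ge\lambda$ for all $\mathbf x\in\Omega$, and that correspond to a $k$-factor model, i.e. $P(\mathbf x)=\prod_{\mathbf j}q_{\mathbf j}(x_{j_1},\dots,x_{j_k})$ where each $q_{\mathbf j}$ is a positive function on $\Omega_{\mathbf j}$. *)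

(* Defs.v *)
From HB Require Import structures.
From mathcomp Require Import all_boot all_order all_algebra.
From mathcomp Require Import all_classical all_reals all_analysis.

Set Implicit Arguments.
Unset Strict Implicit.
Unset Printing Implicit Defensive.

Import Order.TTheory GRing.Theory Num.Theory.
Local Open Scope classical_set_scope.
Local Open Scope ring_scope.

Section SampleSpaces.
Variables (n : nat) (Omega : 'I_n -> finType).

Definition sample := {dffun forall i : 'I_n, Omega i}.

(* The variables are indexed by 'I_n = {0, ..., n-1} instead of {1, ..., n}. *)
Definition ksubset (k : nat) := {j : {set 'I_n} | #|j| == k}.

(* The product of the Omega i for i in j, indexed by the elements of j rather *)
(* than by 1, ..., k. *)
Definition subsample (k : nat) (j : ksubset k) :=
  {dffun forall i : {i : 'I_n | i \in val j}, Omega (val i)}.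

Definition restr (k : nat) (j : ksubset k) (x : sample) : subsample j :=
  [ffun i : {i : 'I_n | i \in val j} => x (val i)].

End SampleSpaces.

Section DirectSum.
Variables (R : realType) (n : nat) (Omega : 'I_n -> finType) (k : nat).

(* A finite direct sum is a product: f j is the component f_j in V_j. *)
Definition Vsum := {dffun forall j : ksubset n k, {ffun subsample Omega j -> R}}.

Implicit Types f g h : Vsum.

Definition Vsum_zero : Vsum := [ffun j : ksubset n k => 0].
Definition Vsum_opp f : Vsum := [ffun j : ksubset n k => - f j].
Definition Vsum_add f g : Vsum := [ffun j : ksubset n k => f j + g j].
Definition Vsum_scale (a : R) f : Vsum := [ffun j : ksubset n k => a *: f j].

Fact Vsum_addA : associative Vsum_add.
Proof. by move=> f g h; apply/ffunP => j; rewrite !ffunE addrA. Qed.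
Fact Vsum_addC : commutative Vsum_add.
Proof. by move=> f g; apply/ffunP => j; rewrite !ffunE addrC. Qed.
Fact Vsum_add0 : left_id Vsum_zero Vsum_add.
Proof. by move=> f; apply/ffunP => j; rewrite !ffunE add0r. Qed.
Fact Vsum_addN : left_inverse Vsum_zero Vsum_opp Vsum_add.
Proof. by move=> f; apply/ffunP => j; rewrite !ffunE addNr. Qed.

HB.instance Definition _ := Choice.on Vsum.
HB.instance Definition _ :=
  GRing.isZmodule.Build Vsum Vsum_addA Vsum_addC Vsum_add0 Vsum_addN.

Fact Vsum_scaleA (a b : R) f :
  Vsum_scale a (Vsum_scale b f) = Vsum_scale (a * b) f.
Proof. by apply/ffunP => j; rewrite !ffunE scalerA. Qed.
Fact Vsum_scale1 : left_id 1 Vsum_scale.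
Proof. by move=> f; apply/ffunP => j; rewrite !ffunE scale1r. Qed.
Fact Vsum_scaleDr : right_distributive Vsum_scale +%R.
Proof. by move=> a f g; apply/ffunP => j; rewrite !ffunE scalerDr. Qed.
Fact Vsum_scaleDl f : {morph Vsum_scale^~ f : a b / a + b}.
Proof. by move=> a b; apply/ffunP => j; rewrite !ffunE scalerDl. Qed.

HB.instance Definition _ := GRing.Zmodule_isLmodule.Build R Vsum
  Vsum_scaleA Vsum_scale1 Vsum_scaleDr Vsum_scaleDl.

End DirectSum.

Section Optimization.
Variable R : realType.

Definition minimizers (T : Type) (D : set T) (F : T -> R) : set T :=
  [set a | D a /\ forall b, D b -> F a <= F b].

Definition convex_program (V : lmodType R) (D : set V) (F : V -> R) : Prop :=
  convex_set D /\ convex_function D F.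

End Optimization.

Section FactorModels.
Variables (R : realType) (n : nat) (Omega : 'I_n -> finType).

Definition is_distribution (P : {ffun sample Omega -> R}) : Prop :=
  (forall x, 0 <= P x) /\ \sum_x P x = 1.

Definition is_factor_model (k : nat) (P : {ffun sample Omega -> R}) : Prop :=
  exists q : forall j : ksubset n k, subsample Omega j -> R,
    (forall j y, 0 < q j y) /\
    forall x, P x = \prod_(j : ksubset n k) q j (restr j x).

Definition model_class (k : nat) (lambda : R) : set {ffun sample Omega -> R} :=
  [set P | [/\ is_distribution P, forall x, lambda <= P x
             & is_factor_model k P]].

Definition empirical_risk (l : nat) (xs : 'I_l -> sample Omega)
    (P : {ffun sample Omega -> R}) : R :=
  - (l%:R^-1 * \sum_(i < l) ln (P (xs i))).

Definition Gfun (k : nat) (x : sample Omega) (f : Vsum R Omega k) : R :=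
  \sum_(j : ksubset n k) f j (restr j x).

Definition Zfun (k : nat) (f : Vsum R Omega k) : R :=
  \sum_(x : sample Omega) expR (\sum_(j : ksubset n k) f j (restr j x)).

Definition log_risk (k l : nat) (xs : 'I_l -> sample Omega)
    (f : Vsum R Omega k) : R :=
  - (l%:R^-1 * \sum_(i < l) \sum_(j : ksubset n k) f j (restr j (xs i))).

Definition feasible (k : nat) (lambda : R) : set (Vsum R Omega k) :=
  [set f | Zfun f = 1 /\ forall x, ln lambda <= Gfun x f].

(* The level set {Z = 1} of the convex function Z is in general not convex,   *)
(* the sublevel set {Z <= 1} is.                                              *)
Definition sublevel_feasible (k : nat) (lambda : R) : set (Vsum R Omega k) :=
  [set f | Zfun f <= 1 /\ forall x, ln lambda <= Gfun x f].

Definition measure_of (k : nat) (f : Vsum R Omega k) : {ffun sample Omega -> R} :=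
  [ffun x => expR (Gfun x f)].

End FactorModels.

Arguments model_class {R n} Omega k lambda.
Arguments feasible {R n} Omega k lambda.
Arguments sublevel_feasible {R n} Omega k lambda.
Arguments Gfun {R n Omega k} x f.
Arguments Zfun {R n Omega k} f.
Arguments log_risk {R n Omega k l} xs f.
Arguments measure_of {R n Omega k} f.

(* Main.v *)
Require Import Defs.
From mathcomp Require Import all_boot all_order all_algebra.
From mathcomp Require Import all_classical all_reals all_analysis.
Import Order.TTheory GRing.Theory Num.Theory.
Local Open Scope classical_set_scope.
Local Open Scope ring_scope.

Section MinimizersAndLinearity.
Set Implicit Arguments.
Unset Strict Implicit.

(** Logarithms turn a product of positive factors q_j into a sum of functions f_j, so [measure_of]
    maps the feasible vectors onto the model class ([model_classE]) and the two risks agree along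
    it. Minimizers then correspond by [minimizers_image], although [measure_of] need not be
    injective. [Gfun x] and [log_risk xs] are linear, and [Zfun] is convex as a sum of exponentials
    of linear functionals. Since Z = 1 need not cut out a convex set, it is relaxed to Z <= 1;
    [sublevel_feasible_improve] with [minimizers_superset] shows that this creates and loses no
    minimizer. *)

Lemma minimizers_image (R : realType) (T U : Type) (D : set T) (h : T -> U)
    (F : U -> R) (G : T -> R) :
  (forall a, D a -> F (h a) = G a) ->
  minimizers (h @` D) F = h @` minimizers D G.
Proof.
move=> FG; apply/seteqP; split=> [_ [[a Da <-] minF]|_ [a [Da minG] <-]].
  exists a => //; split=> // b Db.
  by rewrite -!FG//; apply: minF; exists b.
split; first by exists a.
by move=> _ [b Db <-]; rewrite !FG//; exact: minG.
Qed.

(** A minimizer on [D'] cannot be strictly beaten, so it lies in [D]; a minimizer on [D] bounds the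
    remaining points of [D'] by transitivity. *)
Lemma minimizers_superset (R : realType) (T : Type) (D D' : set T) (F : T -> R) :
  D `<=` D' ->
  (forall b, D' b -> D b \/ exists2 a, D a & F a < F b) ->
  minimizers D F = minimizers D' F.
Proof.
move=> DD' better; apply/seteqP; split=> [a [Da mina]|a [D'a mina]]; split.
- exact: DD'.
- move=> b /better[/mina//|[c Dc /ltW]]; exact/le_trans/mina.
- have [//|[b Db]] := better _ D'a.
  by rewrite ltNge mina//; exact: DD'.
- by move=> b /DD'; exact: mina.
Qed.

Lemma scalar_conv (R : realType) (V : lmodType R) (F : V -> R)
    (t : {i01 R}) (x y : convex_lmodType V) :
  scalar F -> F (conv t x y) = conv t (F x : R^o) (F y : R^o).
Proof.
move=> linF.
have F0 : F 0 = 0.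
  by have := linF (-1) 0 0; rewrite scaler0 addr0 mulN1r addNr.
have FZ a u : F (a *: u) = a * F u.
  by rewrite -[a *: u]addr0 linF F0 addr0.
by rewrite /conv /= linF FZ.
Qed.

End MinimizersAndLinearity.

Section FactorModelProgram.
Set Implicit Arguments.
Unset Strict Implicit.

Variables (R : realType) (n : nat) (Omega : 'I_n -> finType) (k : nat).
Implicit Types (x : sample Omega) (f g : Vsum R Omega k).

Lemma Gfun_scalar x : scalar (Gfun x : Vsum R Omega k -> R).
Proof.
move=> a f g; rewrite /Gfun mulr_sumr -big_split/=.
by apply: eq_bigr => j _; rewrite !ffunE.
Qed.

Lemma log_riskE (l : nat) (xs : 'I_l -> sample Omega) f :
  log_risk xs f = - (l%:R^-1 * \sum_(i < l) Gfun (xs i) f).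
Proof. by []. Qed.

Lemma log_risk_scalar (l : nat) (xs : 'I_l -> sample Omega) :
  scalar (log_risk xs : Vsum R Omega k -> R).
Proof.
move=> a f g; rewrite !log_riskE; under eq_bigr do rewrite Gfun_scalar.
by rewrite big_split/= -mulr_sumr mulrDr opprD mulrCA mulrN.
Qed.

Lemma Zfun_convex : convex_function [set: Vsum R Omega k] Zfun.
Proof.
move=> t f g _ _; rewrite /Zfun convRE !mulr_sumr -big_split/=.
apply: ler_sum => x _; rewrite -!/(Gfun x _).
by rewrite (scalar_conv _ _ _ (Gfun_scalar x)); exact: convex_expR.
Qed.

Lemma sublevel_feasible_convex (lambda : R) :
  convex_set (sublevel_feasible Omega k lambda : set (Vsum R Omega k)).
Proof.
move=> f g t; rewrite !inE => -[Zf Gf] [Zg Gg].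
have conv_ge (a b c : R) : c <= a -> c <= b -> c <= conv t (a : R^o) (b : R^o).
  move=> ca cb; rewrite -[c](convmm t (c : R^o)) !convRE.
  by apply: lerD; rewrite ler_wpM2l// subr_ge0.
split=> [|x].
  apply: (le_trans (Zfun_convex t _ _)); rewrite ?inE//.
  (* Negation turns the upper bound Z <= 1 into a lower bound, so that [conv_ge] serves both
     constraints. *)
  by rewrite -lerN2 convN; apply: conv_ge; rewrite lerN2.
by rewrite (scalar_conv _ _ _ (Gfun_scalar x)); exact: conv_ge.
Qed.

(** Spreading [c] evenly over the k-subsets gives an element of V^k whose addition shifts every G_x
    by [c], and so multiplies Z by exp c. *)
Definition constant_vector (c : R) : Vsum R Omega k :=
  [ffun j : ksubset n k => [ffun => c / #|{: ksubset n k}|%:R]].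

Lemma Gfun_constant_vector x (c : R) :
  (0 < #|{: ksubset n k}|)%N -> Gfun x (constant_vector c) = c.
Proof.
move=> k_gt0; rewrite /Gfun; under eq_bigr do rewrite !ffunE.
by rewrite sumr_const -[LHS]mulr_natr divfK// pnatr_eq0 -lt0n.
Qed.

(* Without any k-subset (k > n) all of the G_x vanish and Z counts the points *)
(* of Omega.                                                                  *)
Lemma ksubset_gt0 x0 f : Zfun f < 1 -> (0 < #|{: ksubset n k}|)%N.
Proof.
move=> Zlt1; rewrite lt0n; apply: contraTneq Zlt1 => /card0_eq k0; rewrite -leNgt.
rewrite /Zfun (bigD1 x0)//= [X in expR X]big_pred0 => [|j]; last exact: k0 j.
by rewrite expR0 lerDl; apply: sumr_ge0 => x _; exact: expR_ge0.
Qed.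

Lemma Zfun_gt0 x0 f : 0 < Zfun f.
Proof.
rewrite /Zfun (bigD1 x0)//= ltr_pwDl ?expR_gt0//.
by apply: sumr_ge0 => x _; exact: expR_ge0.
Qed.

(* Adding the constant - ln (Z f) > 0 normalizes f and raises every G_x,      *)
(* so it lowers the risk strictly; hence no minimizer on {Z <= 1} has Z < 1.  *)
Lemma sublevel_feasible_improve (l : nat) (xs : 'I_l -> sample Omega)
    (lambda : R) f :
  (0 < l)%N -> sublevel_feasible Omega k lambda f ->
  feasible Omega k lambda f \/
  exists2 g, feasible Omega k lambda g & log_risk xs g < log_risk xs f.
Proof.
move=> l_gt0 [+ Gf]; rewrite le_eqVlt => /predU1P[Zf|Zlt1]; first by left.
(* A training point shows that Omega is nonempty, whence Z > 0 and ln Z is meaningful. *)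
right; pose x0 := xs (Ordinal l_gt0).
have k_gt0 := ksubset_gt0 x0 Zlt1; have Zgt0 := Zfun_gt0 x0 f.
pose c := - ln (Zfun f); have c_gt0 : 0 < c by rewrite oppr_gt0 ln_lt0// Zgt0.
pose g := f + constant_vector c.
have Gg x : Gfun x g = Gfun x f + c.
  by have := Gfun_scalar x 1 f (constant_vector c); rewrite scale1r mul1r
    Gfun_constant_vector.
exists g.
  split=> [|x]; last by rewrite Gg (le_trans (Gf x))// lerDl ltW.
  rewrite /Zfun; under eq_bigr do rewrite [X in expR X]Gg expRD.
  by rewrite -mulr_suml expRN lnK ?posrE// divff// gt_eqF.
rewrite !log_riskE ltrN2 ltr_pM2l ?invr_gt0 ?ltr0n//.
apply: ltr_sum => [|i _].
  by apply/hasP; exists (Ordinal l_gt0); rewrite ?mem_index_enum.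
by rewrite Gg ltrDl.
Qed.

Lemma ln_measure_of f x : ln (measure_of f x) = Gfun x f.
Proof. by rewrite ffunE expRK. Qed.

Lemma empirical_risk_measure_of (l : nat) (xs : 'I_l -> sample Omega) f :
  empirical_risk xs (measure_of f) = log_risk xs f.
Proof. by rewrite /empirical_risk; under eq_bigr do rewrite ln_measure_of. Qed.

Lemma model_classE (lambda : R) : 0 < lambda ->
  model_class Omega k lambda = measure_of @` feasible Omega k lambda.
Proof.
move=> lambda_gt0; apply/seteqP; split=> [P [[_ P1] Pge [q [q_gt0 Pq]]]|].
  (* Positivity of the factors makes [ln] invertible on them. *)
  pose f : Vsum R Omega k := [ffun j : ksubset n k => [ffun y => ln (q j y)]].
  have Pf x : expR (Gfun x f) = P x.
    rewrite Pq /Gfun expR_sum; apply: eq_bigr => j _.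
    by rewrite !ffunE lnK// posrE.
  exists f; last by apply/ffunP => x; rewrite ffunE Pf.
  split; first by rewrite -P1; apply: eq_bigr => x _; exact: Pf.
  by move=> x; rewrite -ler_expR Pf lnK// posrE.
move=> _ [f [Z1 Gf] <-]; split.
- split=> [x|]; first by rewrite ffunE expR_ge0.
  by rewrite -Z1; apply: eq_bigr => x _; rewrite ffunE.
- by move=> x; rewrite ffunE -[leLHS]lnK ?posrE// ler_expR.
- exists (fun j y => expR (f j y)); split=> [j y|x]; first exact: expR_gt0.
  by rewrite ffunE expR_sum.
Qed.

End FactorModelProgram.

Theorem mainTheorem4 (R : realType) (n : nat) (Omega : 'I_n -> finType)
    (l : nat) (l_gt0 : (0 < l)%N) (xs : 'I_l -> sample Omega)
    (k : nat) (lambda : R) (lambda_gt0 : 0 < lambda) :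
  let V := Vsum R Omega k in
  (* the feasible vectors f parametrize the class of k-factor models through
     ln P = sum_j f_j, and the two objective functions correspond *)
  [/\ model_class Omega k lambda = measure_of @` feasible Omega k lambda,
      forall f : V, feasible Omega k lambda f ->
        (forall x : sample Omega, ln (measure_of f x) =
           \sum_(j : ksubset n k) f j (restr j x)) /\
        empirical_risk xs (measure_of f) = log_risk xs f,
  (* the two minimization problems have the same solutions *)
      minimizers (model_class Omega k lambda) (empirical_risk xs) =
        measure_of @` minimizers (feasible Omega k lambda) (log_risk xs) &
  (* convexity of the problem in f *)
      [/\ scalar (log_risk xs : V -> R),
          forall x : sample Omega, scalar (Gfun x : V -> R),
          convex_function [set: V] Zfun,
          convex_program (sublevel_feasible Omega k lambda : set V)
            (log_risk xs) &
          minimizers (feasible Omega k lambda) (log_risk xs) =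
            minimizers (sublevel_feasible Omega k lambda) (log_risk xs)]].
Proof.
have riskE f : feasible Omega k lambda f ->
  empirical_risk xs (measure_of f) = log_risk xs f.
  by move=> _; exact: empirical_risk_measure_of.
split.
- exact: model_classE.
- by move=> f /riskE; split=> // x; exact: ln_measure_of.
- by rewrite model_classE//; exact: minimizers_image.
- split.
  + exact: log_risk_scalar.
  + exact: Gfun_scalar.
  + exact: Zfun_convex.
  + split; first exact: sublevel_feasible_convex.
    (* For a linear objective the convexity inequality is an equality. *)
    by move=> t f g _ _; rewrite (scalar_conv _ _ _ (log_risk_scalar xs)).
  + apply: minimizers_superset => [f [Z1 Gf]|f].
      by split=> //; rewrite Z1.
    exact: sublevel_feasible_improve.
Qed.
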